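(* Let $(A;*,a_1,a_2,\ldots)$ be a Kauffman bracket magma. Then there is a unique unoriented framed link invariant $P\colon\{\text{unoriented framed links}\}\to A$ such that $P(T_n)=a_n$ for every $n\ge 1$, and such that for every Kauffman bracket skein triple $L, L_0, L_\infty$ one has $$P(L)=P(L_0)*P(L_\infty).$$
   Context: A magma $(A;* )$ is a set $A$ with a binary operation $*$. It is entropic if $(a*b)*(c*d)=(a*c)*(b*d)$ for all $a,b,c,d\in A$. A Kauffman bracket magma $(A;*,a_1,a_2,\ldots)$ is an entropic magma $(A;* )$ with a chosen sequence of (not necessarily distinct) elements $a_1,a_2,\ldots$ of $A$ such that for every $n\ge 1$: (i) $(a_{n+1}*a_n)*(a_{n+2}*a_{n+1})=(a_{n+1}*a_{n+2})*(a_n*a_{n+1})=a_n$; (ii) $(a_n*a_{n+1})*(a_{n+1}*a_n)=a_{n+1}$. Framed links are represented by unoriented link diagrams with the blackboard framing. A framed link invariant is a function on unoriented link diagrams invariant under (planar isotopy and) the second and third Reidemeister moves $R_2,R_3$ (regular isotopy); equivalently, two diagrams on $S^2$ represent ambient isotopic framed links (with blackboard framing) if and only if they are related by $R_2$ and $R_3$ moves. $T_n$ denotes the trivial link of $n$ components with the trivial framing, represented by the diagram consisting of $n$ disjoint circles with no crossings. A Kauffman bracket skein triple $L,L_0,L_\infty$ consists of three unoriented framed links with diagrams that are identical outside a small disk; in the disk $L$ has a single crossing, $L_0$ is obtained by smoothing this crossing so as to join the two regions swept out by the overcrossing arc when it is rotated counterclockwise towards the undercrossing arc (the ''A-smoothing''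 of the Kauffman bracket), and $L_\infty$ is obtained by the other smoothing. With this convention, for a positive kink the smoothing $0$ splits off an extra circle, so the one-crossing diagram of the unknot with framing $+1$ has value $a_2*a_1$. *)

(* Defs.v *)
From mathcomp Require Import all_boot.

Set Implicit Arguments.
Unset Strict Implicit.
Unset Printing Implicit Defensive.

Definition entropic (A : Type) (op : A -> A -> A) : Prop :=
  forall a b c d, op (op a b) (op c d) = op (op a c) (op b d).

(* The sequence is indexed from 1: the value [a 0] plays no role. *)
Record kauffman_bracket_magma (A : Type) (op : A -> A -> A) (a : nat -> A) :
    Prop := KauffmanBracketMagma {
  kbm_entropic : entropic op;
  kbm_i_left : forall n, 0 < n ->
    op (op (a n.+1) (a n)) (op (a n.+2) (a n.+1)) = a n;
  kbm_i_right : forall n, 0 < n ->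
    op (op (a n.+1) (a n.+2)) (op (a n) (a n.+1)) = a n;
  kbm_ii : forall n, 0 < n ->
    op (op (a n) (a n.+1)) (op (a n.+1) (a n)) = a n.+1
}.

(* A link diagram in the plane, in general position with respect to the      *)
(* height function, is a stack of horizontal slices, listed from bottom to   *)
(* top. Each slice contains a single minimum, maximum or crossing, with only *)
(* vertical strands beside it. In [Cross true] the overcrossing arc runs     *)
(* from bottom left to top right; in [Cross false] it runs from bottom right *)
(* to top left.                                                              *)
Inductive piece := Cup | Cap | Cross of bool.

(* [(p, i)] is the slice where exactly i vertical strands lie left of p. *)
Definition slice := (piece * nat)%type.

Definition strands_in (p : piece) : nat := if p is Cup then 0 else 2.
Definition strands_out (p : piece) : nat := if p is Cap then 0 else 2.

(* [is_tangle w m n]: w has m bottom end points and n top end points, and    *)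
(* each piece finds enough strands below it.                                 *)
Fixpoint is_tangle (w : seq slice) (m n : nat) : bool :=
  if w is (p, i) :: w' then
    (i + strands_in p <= m) &&
    is_tangle w' (m - strands_in p + strands_out p) n
  else m == n.

(* Links have at least one component, so the empty diagram is excluded:      *)
(* nothing would determine an invariant on it, since a_0 is not given.       *)
Definition is_link_diagram (w : seq slice) : bool :=
  (0 < size w) && is_tangle w 0 0.

Definition link_diagram := {w : seq slice | is_link_diagram w}.

(* Generators of planar isotopy: exchanging the heights of two pieces with p *)
(* on the left of q; creating or cancelling a maximum-minimum pair; and      *)
(* moving a crossing over a maximum or minimum, from one leg to the other    *)
(* (the sign changes because the same arc stays on top).                     *)
Inductive planar_isotopy_move : seq slice -> seq slice -> Prop :=
| IsoExchange p q i k :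
    planar_isotopy_move [:: (p, i); (q, i + strands_out p + k)]
                        [:: (q, i + strands_in p + k); (p, i)]
| IsoZigzagL i : planar_isotopy_move [:: (Cup, i); (Cap, i.+1)] [::]
| IsoZigzagR i : planar_isotopy_move [:: (Cup, i.+1); (Cap, i)] [::]
| IsoCrossCap b i :
    planar_isotopy_move [:: (Cross b, i); (Cap, i.+1)]
                        [:: (Cross (~~ b), i.+1); (Cap, i)]
| IsoCupCross b i :
    planar_isotopy_move [:: (Cup, i); (Cross b, i.+1)]
                        [:: (Cup, i.+1); (Cross (~~ b), i)].

Inductive reidemeister2 : seq slice -> seq slice -> Prop :=
| R2 b i : reidemeister2 [:: (Cross b, i); (Cross (~~ b), i)] [::].

(* The strands numbered 1, 2, 3 from left to right at the bottom cross in    *)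
(* pairs: b12, b13 and b23 tell whether the strand with the smaller number   *)
(* is the upper one. The hypothesis says that the three strands lie at three *)
(* distinct levels, i.e., that "being over" is not cyclic.                   *)
Inductive reidemeister3 : seq slice -> seq slice -> Prop :=
| R3 b12 b13 b23 i of (b13 == b12) || (b13 == b23) :
    reidemeister3 [:: (Cross b12, i); (Cross b13, i.+1); (Cross b23, i)]
                  [:: (Cross b23, i.+1); (Cross b13, i); (Cross b12, i.+1)].

Definition shift_right (w : seq slice) : seq slice :=
  [seq (s.1, s.2.+1) | s <- w].

(* Diagrams live on the sphere: besides planar isotopy, an outermost arc may *)
(* be moved across the point at infinity. Up to planar isotopy this turns    *)
(* the closure of a 1-tangle by an arc on its left into its closure by an    *)
(* arc on its right.                                                         *)
Inductive sphere_move : seq slice -> seq slice -> Prop :=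
| SphereMove w of is_tangle w 1 1 :
    sphere_move ((Cup, 0) :: shift_right w ++ [:: (Cap, 0)])
                ((Cup, 0) :: w ++ [:: (Cap, 0)]).

Inductive diagram_move : seq slice -> seq slice -> Prop :=
| MoveIsotopy u l r v of planar_isotopy_move l r :
    diagram_move (u ++ l ++ v) (u ++ r ++ v)
| MoveSphere l r of sphere_move l r : diagram_move l r
| MoveR2 u l r v of reidemeister2 l r :
    diagram_move (u ++ l ++ v) (u ++ r ++ v)
| MoveR3 u l r v of reidemeister3 l r :
    diagram_move (u ++ l ++ v) (u ++ r ++ v).

(* Both sides are required to be diagrams, so a local move is only performed *)
(* where enough strands are present. Framed links are the classes of link    *)
(* diagrams under the equivalence relation generated by these moves.         *)
Definition framed_link_invariant (A : Type) (P : link_diagram -> A) : Prop :=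
  forall D D' : link_diagram, diagram_move (val D) (val D') -> P D = P D'.

Definition circles (n : nat) : seq slice :=
  flatten (nseq n [:: (Cup, 0); (Cap, 0)]).

Lemma circles_link_diagram n : 0 < n -> is_link_diagram (circles n).
Proof.
have tangle_circles k : is_tangle (circles k) 0 0 by elim: k.
by case: n => // n _; rewrite /is_link_diagram tangle_circles.
Qed.

Definition trivial_link (n : nat) (n_gt0 : 0 < n) : link_diagram :=
  exist _ (circles n) (circles_link_diagram n_gt0).

(* Rotating the overcrossing arc of [Cross true] counterclockwise sweeps out *)
(* the regions above and below the crossing; joining them leaves two         *)
(* vertical strands. For [Cross false] the swept regions are those on the    *)
(* left and on the right, and joining them leaves a maximum below a minimum. *)
Definition smoothing_0 (b : bool) (i : nat) : seq slice :=
  if b then [::] else [:: (Cap, i); (Cup, i)].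

Definition smoothing_inf (b : bool) (i : nat) : seq slice :=
  smoothing_0 (~~ b) i.

Definition skein_triple (L L0 Linf : link_diagram) : Prop :=
  exists u v b i,
    [/\ val L = u ++ (Cross b, i) :: v,
        val L0 = u ++ smoothing_0 b i ++ v
      & val Linf = u ++ smoothing_inf b i ++ v].

(* Main.v *)
Require Import Defs.
From mathcomp Require Import all_boot zify.
From Stdlib Require Import FunctionalExtensionality.

Set Implicit Arguments.
Unset Strict Implicit.
Unset Printing Implicit Defensive.

(** Existence. Smooth every crossing in both ways, give a crossingless diagram
    with n loops the value a_n, and combine the 2 ^ c values by op along the
    crossings, listed from bottom to top ([bracket]). By entropicity op is a
    homomorphism from A x A to A, so the combined value does not depend on the
    order in which the crossings are resolved ([state_sum_exchange]); hence the
    skein relation holds at every crossing ([bracket_skein]), and a local move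
    may be checked on diagrams without crossings outside the moving part
    ([bracket_equiv_flat]).

    For the second Reidemeister move, let k be the number of loops of a state
    in which the two strands run vertically, and k' the number of loops once a
    maximum followed by a minimum is inserted there. The four states of the
    left side have k, k', k' and k'+1 loops, and k' is k+1 or k-1
    ([surgery_loops]). The three magma axioms say exactly that the value is a_k
    in each case. As for the usual bracket, the third move and the passage of a
    crossing over an extremum follow by resolving one crossing, and invariance
    on the sphere amounts to the fact that both closures of a 1-tangle have the
    same loops.

    Counting loops. Loops are counted through colourings of the strands by two
    colours, which are visibly invariant under planar isotopy; a crossingless
    diagram has 2 ^ loops of them. That the number of loops changes by exactly
    one under a surgery has two sources. Colourings form a vector space over
    the field with two elements and a surgery replaces one linear condition by
    another, so their number changes by a factor 1/2, 1 or 2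
    ([surgery_colourings]). Planarity excludes the factor 1: the parity of the
    number of loops is the parity of a sum over the slices, and a surgery
    changes it ([flat_parity]).

    Uniqueness. Crossingless diagrams reduce to a row of circles by planar
    isotopy and the second Reidemeister move, which takes a circle across a
    strand ([circle_across_strand], [flat_loops]). So the values on trivial
    links determine an invariant on crossingless diagrams, and the skein
    relation determines it on all others by induction on the number of
    crossings. The same normal form shows that the number of colourings is a
    power of two and identifies the parity. *)

(** * Composing tangles *)

Lemma tangle_cat u v m k n :
  is_tangle u m k -> is_tangle (u ++ v) m n = is_tangle v k n.
Proof.
elim: u m => [|[p i] u IHu] m /=; first by move/eqP->.
by case/andP=> -> /IHu->.
Qed.

Lemma tangle_split u v m n :
  is_tangle (u ++ v) m n -> exists2 k, is_tangle u m k & is_tangle v k n.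
Proof.
elim: u m => [|[p i] u IHu] m /=; first by exists m.
by case/andP=> -> /IHu[k]; exists k.
Qed.

Lemma tangle_smoothing c b i m : i + 2 <= m ->
  is_tangle (smoothing_0 c i) m m /\ is_tangle [:: (Cross b, i)] m m.
Proof. by move=> le_m; case: c => /=; split; lia. Qed.

Lemma tangle_circles k n : is_tangle (circles k) n n.
Proof.
elim: k => [|k IHk]; first exact: eqxx.
rewrite /= -/(circles k); have ->: n - 0 + 2 - 2 + 0 = n by lia.
by rewrite IHk andbT; lia.
Qed.

(** * Colourings of the strands *)

(** A strand keeps its colour through a crossing, so that the components of the
    link are coloured. *)
Definition outs (p : piece) (x : seq bool) : seq (seq bool) :=
  match p, x with
  | Cup, [::] => [:: [:: true; true]; [:: false; false]]
  | Cap, [:: b; c] => if b == c then [:: [::]] else [::]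
  | Cross _, [:: b; c] => [:: [:: c; b]]
  | _, _ => [::]
  end.

(** With a weight [K] on the colours at the top, rather than prescribed colours
    there, stacking tangles becomes composing operators on weights. *)
Fixpoint colourings (w : seq slice) (K : seq bool -> nat) (t : seq bool) :=
  if w is (p, i) :: w' then
    \sum_(x <- outs p (take (strands_in p) (drop i t)))
      colourings w' K (take i t ++ x ++ drop (i + strands_in p) t)
  else K t.

Lemma size_outs p x y : y \in outs p x -> size y = strands_out p.
Proof.
case: p x => [||b] [|b1 [|b2 [|b3 x]]] //=.
- by rewrite !inE => /orP[] /eqP->.
- by case: ifP => // _; rewrite inE => /eqP->.
- by rewrite inE => /eqP->.
Qed.

Lemma colourings_cat u v K t :
  colourings (u ++ v) K t = colourings u (colourings v K) t.
Proof.
elim: u t => [|[p i] u IHu] t //=.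
by apply: eq_bigr => x _; rewrite IHu.
Qed.

Lemma colourings_cons p i w K t1 t2 t3 :
  size t1 = i -> size t2 = strands_in p ->
  colourings ((p, i) :: w) K (t1 ++ t2 ++ t3) =
  \sum_(x <- outs p t2) colourings w K (t1 ++ x ++ t3).
Proof.
move=> <- st2 /=; rewrite drop_size_cat // take_size_cat //.
by rewrite take_size_cat // addnC -drop_drop drop_size_cat // drop_size_cat.
Qed.

Lemma split_at (T : Type) (t : seq T) i j :
  i + j <= size t ->
  exists t1 t2 t3, [/\ t = t1 ++ t2 ++ t3, size t1 = i & size t2 = j].
Proof.
move=> le_ij; exists (take i t), (take j (drop i t)), (drop j (drop i t)).
by rewrite !cat_take_drop !size_take_min size_drop; split=> //; lia.
Qed.

Lemma eq_colourings w m n K K' :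
  is_tangle w m n -> (forall t, size t = n -> K t = K' t) ->
  forall t, size t = m -> colourings w K t = colourings w K' t.
Proof.
move=> tw eqK; elim: w m tw => [|[p i] w IHw] m /=.
  by move/eqP=> -> t; apply: eqK.
case/andP=> le_m tw t st.
have [t1 [t2 [t3 [def_t st1 st2]]]] : exists t1 t2 t3,
  [/\ t = t1 ++ t2 ++ t3, size t1 = i & size t2 = strands_in p].
  by apply: split_at; rewrite st.
rewrite -!/(colourings ((p, i) :: w) _ _) def_t !colourings_cons //.
rewrite !big_seq; apply: eq_bigr => x /size_outs sx.
by apply: (IHw _ tw); move: st; rewrite def_t !size_cat sx; lia.
Qed.

(** Quantifying over all weights makes this the equality of the operators
    attached to [l] and [r], which is a congruence for stacking. *)
Definition equicolourable m l r := forall K t,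
  size t = m -> colourings l K t = colourings r K t.

(** The two pieces act on disjoint blocks of colours, so exchanging them is
    exchanging two sums. *)
Lemma exchange_equicolourable p q i k m n :
  is_tangle [:: (p, i); (q, i + strands_out p + k)] m n ->
  equicolourable m [:: (p, i); (q, i + strands_out p + k)]
                   [:: (q, i + strands_in p + k); (p, i)].
Proof.
rewrite /= => /and3P[le1 le2 _] K t st.
have [t1 [t2 [t' [def_t st1 st2]]]] :
    exists t1 t2 t3, [/\ t = t1 ++ t2 ++ t3, size t1 = i & size t2 = strands_in p].
  by apply: split_at; lia.
have st' : size t' = m - i - strands_in p.
  by move: st; rewrite def_t !size_cat; lia.
have [t3 [t4 [t5 [def_t' st3 st4]]]] :
    exists t1 t2 t3, [/\ t' = t1 ++ t2 ++ t3, size t1 = k & size t2 = strands_in q].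
  by apply: split_at; lia.
transitivity (\sum_(x <- outs p t2) \sum_(y <- outs q t4)
                K (t1 ++ x ++ t3 ++ y ++ t5)).
  rewrite def_t colourings_cons // def_t' !big_seq.
  apply: eq_bigr => x /size_outs sx.
  have -> : t1 ++ x ++ t3 ++ t4 ++ t5 = (t1 ++ x ++ t3) ++ t4 ++ t5.
    by rewrite -!catA.
  rewrite colourings_cons // ?size_cat ?sx ?st1 ?st3 //; last by lia.
  by apply: eq_bigr => y _; rewrite -!catA.
rewrite exchange_big def_t def_t' /=.
have -> : t1 ++ t2 ++ t3 ++ t4 ++ t5 = (t1 ++ t2 ++ t3) ++ t4 ++ t5.
  by rewrite -!catA.
rewrite -/(colourings [:: (q, i + strands_in p + k); (p, i)] K _).
rewrite colourings_cons // ?size_cat ?st1 ?st2 ?st3 //; last by lia.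
apply: eq_bigr => y _; rewrite -!catA.
by rewrite colourings_cons.
Qed.

Definition shift (n : nat) (w : seq slice) : seq slice :=
  [seq (s.1, n + s.2) | s <- w].

Lemma colourings_shift w K t1 t2 :
  colourings (shift (size t1) w) K (t1 ++ t2) =
  colourings w (fun t => K (t1 ++ t)) t2.
Proof.
elim: w t2 => [|[p i] w IHw] t2 //=.
rewrite drop_cat ltnNge leq_addr /= addKn take_cat ltnNge leq_addr /= addKn.
apply: eq_bigr => x _; rewrite -catA drop_cat -addnA.
by rewrite ltnNge leq_addr /= addKn IHw.
Qed.

(** Reduces a local move at position [i] to the leftmost position, where
    it is a computation on the first [c] colours. *)
Lemma equicolourable_shift i c m l r :
  (forall K t, c <= size t -> colourings l K t = colourings r K t) ->
  i + c <= m -> equicolourable m (shift i l) (shift i r).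
Proof.
move=> eq_lr le_m K t st; have [t1 [t2 [t3 [-> st1 st2]]]] :
    exists t1 t2 t3, [/\ t = t1 ++ t2 ++ t3, size t1 = i & size t2 = c].
  by apply: split_at; lia.
by rewrite -st1 !colourings_shift eq_lr // size_cat st2 leq_addr.
Qed.

Lemma planar_isotopy_equicolourable l r m n :
  planar_isotopy_move l r -> is_tangle l m n -> equicolourable m l r.
Proof.
have sumE := (big_cons, big_nil, addn0).
case=> {l r} [p q i k|i|i|b i|b i].
- exact: exchange_equicolourable.
- move=> /= /and3P[_ le_m _].
  have := @equicolourable_shift i 1 m [:: (Cup, 0); (Cap, 1)] [::].
  rewrite /shift /= (addn0 i) (addn1 i); apply; last by lia.
  by move=> K [|[] t] //= _; rewrite !(sumE, drop0) /= ?sumE ?take0 ?drop0 ?sumE.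
- move=> /= /and3P[le_m _ _].
  have := @equicolourable_shift i 1 m [:: (Cup, 1); (Cap, 0)] [::].
  rewrite /shift /= (addn0 i) (addn1 i); apply; last by lia.
  by move=> K [|[] t] //= _; rewrite !(sumE, drop0) /= ?sumE ?take0 ?drop0 ?sumE.
- move=> /= /and3P[_ le_m _].
  have := @equicolourable_shift i 3 m [:: (Cross b, 0); (Cap, 1)]
            [:: (Cross (~~ b), 1); (Cap, 0)].
  rewrite /shift /= (addn0 i) (addn1 i); apply; last by lia.
  move=> K [|x [|y [|z t]]] //= _; rewrite !(sumE, drop0) /= ?take0 ?drop0 ?sumE /=.
  by case: eqP; rewrite !sumE ?drop0.
- move=> /= /and3P[_ le_m _].
  have := @equicolourable_shift i 1 m [:: (Cup, 0); (Cross b, 1)]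
            [:: (Cup, 1); (Cross (~~ b), 0)].
  rewrite /shift /= (addn0 i) (addn1 i); apply; last by lia.
  by move=> K [|[] t] //= _; rewrite !(sumE, drop0) /= ?sumE ?take0 ?drop0 ?sumE.
Qed.

Lemma reidemeister2_equicolourable l r m n :
  reidemeister2 l r -> is_tangle l m n -> equicolourable m l r.
Proof.
case=> {l r} b i /= /and3P[le_m _ _].
have := @equicolourable_shift i 2 m [:: (Cross b, 0); (Cross (~~ b), 0)] [::].
rewrite /shift /= (addn0 i); apply; last by lia.
by move=> K [|x [|y t]] //= _;
  do 2!rewrite /= ?take0 ?drop0 ?(big_cons, big_nil, addn0).
Qed.

Lemma circle_colourings i K t :
  i <= size t -> colourings [:: (Cup, i); (Cap, i)] K t = 2 * K t.
Proof.
move=> le_i; have [t1 [t2 [t3 [-> st1 /size0nil->]]]] :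
    exists t1 t2 t3, [/\ t = t1 ++ t2 ++ t3, size t1 = i & size t2 = 0].
  by apply: split_at; rewrite addn0.
have -> : [:: (Cup, i); (Cap, i)] = shift (size t1) [:: (Cup, 0); (Cap, 0)].
  by rewrite /shift /= st1 addn0.
rewrite colourings_shift /=.
do 3!rewrite ?take0 ?drop0 ?(big_cons, big_nil, addn0) /=.
by rewrite mul2n addnn.
Qed.

(** * Colourings form a vector space over the field with two elements *)

Definition xor_seq (s t : seq bool) := [seq x.1 (+) x.2 | x <- zip s t].

Lemma xor_seq_cat s1 s2 t1 t2 : size s1 = size t1 ->
  xor_seq (s1 ++ s2) (t1 ++ t2) = xor_seq s1 t1 ++ xor_seq s2 t2.
Proof. by move=> eq_sz; rewrite /xor_seq zip_cat // map_cat. Qed.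

Lemma size_xor_seq s t : size s = size t -> size (xor_seq s t) = size t.
Proof. by move=> eq_sz; rewrite size_map size2_zip ?eq_sz. Qed.

(** If [K] is not identically zero this says that [K] is a constant multiple of
    the indicator of a subgroup of the words of length [n] under [xor_seq]: every
    element of the support is a period. *)
Definition subgroup_multiple (n : nat) (K : seq bool -> nat) : Prop :=
  forall s t, size s = n -> size t = n -> 0 < K s -> K (xor_seq s t) = K t.

(** The colours above a piece depend linearly on those below: the fibre over a
    sum is the translate by [x] of a fibre. *)
Lemma outs_xor p s t x : size s = strands_in p -> size t = strands_in p ->
  x \in outs p s ->
  perm_eq (outs p (xor_seq s t)) [seq xor_seq x y | y <- outs p t].
Proof.
case: p => [||b].
- move=> /size0nil-> /size0nil->.
  by rewrite /= !inE => /orP[] /eqP->.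
- case: s t => [|s1 [|s2 []]] // [|t1 [|t2 []]] // _ _.
  by case: s1 s2 t1 t2 => [] [] [] [] //=; rewrite inE => /eqP->.
- case: s t => [|s1 [|s2 []]] // [|t1 [|t2 []]] // _ _.
  by rewrite inE => /eqP->.
Qed.

(** Translating by one colouring of positive weight is a bijection between the
    colourings above [t] and those above [xor_seq s t]. *)
Lemma colourings_subgroup w m n K :
  is_tangle w m n -> subgroup_multiple n K -> subgroup_multiple m (colourings w K).
Proof.
move=> tw subK; elim: w m tw => [|[p i] w IHw] m; first by move/eqP->.
move=> /= /andP[le_m tw] s t ss st.
have [s1 [s2 [s3 [def_s ss1 ss2]]]] : exists t1 t2 t3,
    [/\ s = t1 ++ t2 ++ t3, size t1 = i & size t2 = strands_in p].
  by apply: split_at; rewrite ss.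
have [t1 [t2 [t3 [def_t st1 st2]]]] : exists t1 t2 t3,
    [/\ t = t1 ++ t2 ++ t3, size t1 = i & size t2 = strands_in p].
  by apply: split_at; rewrite st.
rewrite -!/(colourings ((p, i) :: w) _ _) def_s def_t.
rewrite !xor_seq_cat ?ss1 ?ss2 //.
rewrite !colourings_cons ?size_xor_seq ?ss1 ?ss2 ?st1 ?st2 //.
rewrite lt0n sum_nat_seq_neq0 => /hasP[x outs_x /= K_x].
rewrite (perm_big _ (outs_xor ss2 st2 outs_x)) big_map /=.
rewrite !big_seq; apply: eq_bigr => y outs_y.
have [sx sy] := (size_outs outs_x, size_outs outs_y).
rewrite -xor_seq_cat ?sx ?sy // -xor_seq_cat ?ss1 ?st1 //.
move: ss st; rewrite def_s def_t !size_cat => ss st.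
by apply: (IHw _ tw); rewrite ?lt0n // !size_cat ?sx ?sy; lia.
Qed.

(** The constant colouring with colour [b] contributes a positive term. *)
Lemma colourings_nseq w m n K b : is_tangle w m n ->
  0 < K (nseq n b) -> 0 < colourings w K (nseq m b).
Proof.
elim: w m => [|[p i] w IHw] m; first by move/eqP->.
move=> /= /andP[le_m tw] K_gt0.
rewrite -!/(colourings ((p, i) :: w) _ _).
have -> : m = i + (strands_in p + (m - strands_in p - i)) by lia.
rewrite !nseqD colourings_cons ?size_nseq //.
rewrite lt0n sum_nat_seq_neq0; apply/hasP; exists (nseq (strands_out p) b).
  by case: p {le_m tw} => [||c]; case: (b).
rewrite -lt0n -!nseqD.
have -> : i + (strands_out p + (m - strands_in p - i))
  = m - strands_in p + strands_out p by lia.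
exact: IHw.
Qed.

Lemma colourings_beside w n K t s : is_tangle w (size t) n ->
  colourings w K (t ++ s) = colourings w (fun t' => K (t' ++ s)) t.
Proof.
elim: w t => [|[p i] w IHw] t //=.
case/andP=> le_m tw; rewrite -!/(colourings ((p, i) :: w) _ _).
have [t1 [t2 [t3 [def_t st1 st2]]]] := split_at le_m.
rewrite def_t -!catA !colourings_cons // !big_seq.
apply: eq_bigr => x /size_outs sx; rewrite -[RHS]IHw ?catA //.
rewrite !size_cat sx; move: tw; rewrite def_t !size_cat.
by congr is_tangle; lia.
Qed.

Lemma sum_colourings (I : Type) (r : seq I) w (K : I -> seq bool -> nat) t :
  colourings w (fun t' => \sum_(j <- r) K j t') t =
  \sum_(j <- r) colourings w (K j) t.
Proof.
elim: w t => [|[p i] w IHw] t //=.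
by rewrite exchange_big; apply: eq_bigr => x _; rewrite IHw.
Qed.

(** The extra last colour, which [u] leaves alone, plays the part of the value of
    a linear form on colourings: its kernel is everything or has index 2, so
    dropping the condition that the form vanishes keeps or doubles the count. *)
Lemma subgroup_doubling u m K : is_tangle u 0 m -> subgroup_multiple m.+1 K ->
  0 < K (nseq m.+1 false) ->
  let k0 := colourings u (fun t => K (t ++ [:: false])) [::] in
  0 < k0 /\ exists b : bool,
    colourings u (fun t => \sum_(c : bool) K (t ++ [:: c])) [::] = 2 ^ b * k0.
Proof.
move=> tu subK K_gt0 k0.
have tu1 : is_tangle u 1 m.+1.
  have tangle_widen w a b : is_tangle w a b -> is_tangle w a.+1 b.+1.
    elim: w a => [|[p i] w IHw] a //= /andP[le_a /IHw].
    rewrite -addSn -subSn; last by lia.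
    by move=> ->; rewrite andbT; lia.
  exact: tangle_widen.
have k1E c : colourings u (fun t => K (t ++ [:: c])) [::] = colourings u K [:: c].
  by rewrite -(colourings_beside (n := m)).
have sub1 := colourings_subgroup tu1 subK.
have k0_gt0 : 0 < k0 by rewrite /k0 k1E (colourings_nseq (b := false) tu1).
split=> //.
rewrite sum_colourings /index_enum /= big_bool /= !k1E -/k0.
have [k1_0|k1_gt0] := posnP (colourings u K [:: true]).
  by exists false; rewrite k1_0 /k0 k1E mul1n.
exists true; rewrite -(sub1 [:: true] [:: true]) //= /k0 k1E.
by rewrite mul2n addnn.
Qed.

Definition empty_top (t : seq bool) : nat := t == [::].

Lemma empty_top_subgroup : subgroup_multiple 0 empty_top.
Proof. by move=> s t /size0nil-> /size0nil->. Qed.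

Definition count_colourings w := colourings w empty_top [::].

(** * Closing a 1-tangle *)

Lemma colourings_shift_right w K x t :
  colourings (shift_right w) K (x :: t) = colourings w (fun t' => K (x :: t')) t.
Proof. exact: (colourings_shift w K [:: x] t). Qed.

(** Both closures are the trace of the 2 x 2 matrix of the 1-tangle [w]: the
    closing arc contributes an identity factor on either side. *)
Lemma count_closure w : is_tangle w 1 1 ->
  count_colourings ((Cup, 0) :: shift_right w ++ [:: (Cap, 0)]) =
  count_colourings ((Cup, 0) :: w ++ [:: (Cap, 0)]).
Proof.
move=> tw; pose K := colourings [:: (Cap, 0)] empty_top.
have KC x y : K [:: x; y] = K [:: y; x] by case: x y => [] [].
have left_right x :
    colourings (shift_right w) K [:: x; x] = colourings w K [:: x; x].
  rewrite colourings_shift_right (@colourings_beside w 1 K [:: x] [:: x]) //.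
  by apply: (eq_colourings tw) => // -[|y []] // _; exact: KC.
have cupE v : count_colourings ((Cup, 0) :: v) =
    colourings v empty_top [:: true; true] + colourings v empty_top [:: false; false].
  by rewrite /count_colourings /= !(big_cons, big_nil) addn0.
by rewrite !cupE !colourings_cat !left_right.
Qed.

(** * Surgery at most doubles or halves the number of colourings *)

Lemma turnback_colourings i K t1 c d t2 : size t1 = i ->
  colourings [:: (Cap, i); (Cup, i)] K (t1 ++ [:: c; d] ++ t2) =
  (c == d) * \sum_(x : bool) K (t1 ++ [:: x; x] ++ t2).
Proof.
move=> st1; rewrite colourings_cons //= big_bool /=.
case: eqP => _; rewrite !(big_cons, big_nil) //.
rewrite -!/(colourings [:: (Cup, i)] _ _) (@colourings_cons _ _ _ _ t1 [::]) //.
by rewrite !(big_cons, big_nil) !addn0 mul1n.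
Qed.

(** Let [z] count the colourings in which all four strand ends at the surgery
    have the same colour. In both diagrams they are the kernel of a linear
    form, the difference of the colours of the two strands involved, so either
    count is [z] or [2 * z]. *)
Lemma surgery_colourings u v m i :
  is_tangle u 0 m -> is_tangle v m 0 -> i + 2 <= m ->
  exists z (b b' : bool), [/\ 0 < z,
    count_colourings (u ++ v) = 2 ^ b * z &
    count_colourings (u ++ [:: (Cap, i); (Cup, i)] ++ v) = 2 ^ b' * z].
Proof.
move=> tu tv le_m; pose W := colourings v empty_top.
have subW : subgroup_multiple m W by apply: colourings_subgroup tv empty_top_subgroup.
have W_gt0 : 0 < W (nseq m false) by apply: (colourings_nseq tv).
pose x1 (t : seq bool) := nth false t i.
pose x2 (t : seq bool) := nth false t i.+1.
(* The last colour of [t] records the value of the linear form: for [KI] the *)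
(* difference of the two vertical strands, for [KE] the difference between   *)
(* the minimum and the maximum.                                              *)
pose KI t := (x1 t (+) x2 t == nth false t m) * W (take m t).
pose KE t := (x1 t == x2 t) * W (take i t ++
   [:: x1 t (+) nth false t m; x2 t (+) nth false t m] ++
   drop i.+2 (take m t)).
have K_ t1 a b t2 c : size t1 = i -> size t2 = m - i - 2 ->
    KI (t1 ++ [:: a; b] ++ t2 ++ [:: c])
      = (a (+) b == c) * W (t1 ++ [:: a; b] ++ t2) /\
    KE (t1 ++ [:: a; b] ++ t2 ++ [:: c])
      = (a == b) * W (t1 ++ [:: a (+) c; b (+) c] ++ t2).
  move=> st1 st2; pose t := t1 ++ [:: a; b] ++ t2.
  have st : size t = m by rewrite !size_cat /=; lia.
  have -> : t1 ++ [:: a; b] ++ t2 ++ [:: c] = t ++ [:: c] by rewrite -!catA.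
  have nth_m : nth false (t ++ [:: c]) m = c by rewrite nth_cat st ltnn subnn.
  have take_m : take m (t ++ [:: c]) = t by rewrite take_size_cat.
  have x1E : x1 (t ++ [:: c]) = a.
    by rewrite /x1 -!catA nth_cat st1 ltnn subnn.
  have x2E : x2 (t ++ [:: c]) = b.
    by rewrite /x2 -!catA nth_cat st1 ltnNge leqnSn /= subSnn.
  have take_i : take i (t ++ [:: c]) = t1 by rewrite -!catA take_size_cat.
  have drop_i : drop i.+2 t = t2.
    by rewrite /t catA drop_size_cat // size_cat st1 addn2.
  by split; rewrite /KI /KE x1E x2E nth_m take_m ?take_i ?drop_i.
have KI_ t1 a b t2 c st1 st2 := proj1 (K_ t1 a b t2 c st1 st2).
have KE_ t1 a b t2 c st1 st2 := proj2 (K_ t1 a b t2 c st1 st2).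
have splitm (t : seq bool) : size t = m -> exists t1 a b t2,
    [/\ t = t1 ++ [:: a; b] ++ t2, size t1 = i & size t2 = m - i - 2].
  move=> st; have [t1 [t' [t2 [def_t st1 st2]]]] : exists t1 t2 t3,
      [/\ t = t1 ++ t2 ++ t3, size t1 = i & size t2 = 2].
    by apply: split_at; rewrite st.
  case: t' st2 def_t => [|a [|b []]] // _ def_t.
  exists t1, a, b, t2; split=> //.
  by move: st; rewrite def_t !size_cat /=; lia.
have splitm1 (t : seq bool) : size t = m.+1 -> exists t1 a b t2 c,
    [/\ t = t1 ++ [:: a; b] ++ t2 ++ [:: c], size t1 = i &
        size t2 = m - i - 2].
  case/lastP: t => // t c; rewrite size_rcons => -[/splitm[t1 [a [b [t2 [-> st1 st2]]]]]].
  by exists t1, a, b, t2, c; rewrite -cats1 -!catA.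
have [subKI subKE] : subgroup_multiple m.+1 KI /\ subgroup_multiple m.+1 KE.
  split=> s t ss st.
    have [s1 [a [b [s2 [c [-> ss1 ss2]]]]]] := splitm1 s ss.
    have [t1 [a' [b' [t2 [c' [-> st1 st2]]]]]] := splitm1 t st.
    rewrite !xor_seq_cat ?ss1 ?ss2 //.
    have sx1 : size (xor_seq s1 t1) = i by rewrite size_xor_seq ?ss1.
    have sx2 : size (xor_seq s2 t2) = m - i - 2 by rewrite size_xor_seq ?ss2.
    rewrite (KI_ _ _ _ _ _ sx1 sx2) (KI_ _ _ _ _ _ ss1 ss2).
    rewrite (KI_ _ _ _ _ _ st1 st2) muln_gt0 lt0b => /andP[/eqP<- W_s].
    rewrite -[_ ++ [:: a (+) a'; _] ++ _]/(_ ++ xor_seq [:: a; b] [:: a'; b'] ++ _).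
    rewrite -!xor_seq_cat ?ss1 ?ss2 // subW // ?size_cat /= ?ss1 ?st1 ?ss2 ?st2; lia.
  have [s1 [a [b [s2 [c [-> ss1 ss2]]]]]] := splitm1 s ss.
  have [t1 [a' [b' [t2 [c' [-> st1 st2]]]]]] := splitm1 t st.
  rewrite !xor_seq_cat ?ss1 ?ss2 //.
  have sx1 : size (xor_seq s1 t1) = i by rewrite size_xor_seq ?ss1.
  have sx2 : size (xor_seq s2 t2) = m - i - 2 by rewrite size_xor_seq ?ss2.
  rewrite (KE_ _ _ _ _ _ sx1 sx2) (KE_ _ _ _ _ _ ss1 ss2).
  rewrite (KE_ _ _ _ _ _ st1 st2) muln_gt0 lt0b => /andP[/eqP<- W_s].
  have -> : [:: (a (+) a') (+) (c (+) c'); (a (+) b') (+) (c (+) c')]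
      = xor_seq [:: a (+) c; a (+) c] [:: a' (+) c'; b' (+) c'].
    by rewrite /xor_seq /= (addbACA a a') (addbACA a b').
  rewrite -!xor_seq_cat ?ss1 ?ss2 // subW //; last 2 first.
  - by rewrite !size_cat ss1 ss2 /=; lia.
  - by rewrite !size_cat st1 st2 /=; lia.
  by rewrite (inj_eq (@addbI a)).
have size_right : size (nseq (m - i - 2) false) = m - i - 2 by rewrite size_nseq.
have nseq_m1 : nseq m.+1 false
    = nseq i false ++ [:: false; false] ++ nseq (m - i - 2) false ++ [:: false].
  rewrite -[[:: false]]/(nseq 1 false) -[[:: false; false]]/(nseq 2 false).
  by rewrite -!nseqD; congr (nseq _ _); lia.
have nseq_m : nseq m false
    = nseq i false ++ [:: false; false] ++ nseq (m - i - 2) false.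
  rewrite -[[:: false; false]]/(nseq 2 false).
  by rewrite -!nseqD; congr (nseq _ _); lia.
have KI_gt0 : 0 < KI (nseq m.+1 false).
  by rewrite nseq_m1 (KI_ _ _ _ _ _ (size_nseq _ _) size_right) mul1n -nseq_m.
have KE_gt0 : 0 < KE (nseq m.+1 false).
  by rewrite nseq_m1 (KE_ _ _ _ _ _ (size_nseq _ _) size_right) mul1n -nseq_m.
have [z_gt0 [b bE]] := subgroup_doubling tu subKI KI_gt0.
have [_ [b' b'E]] := subgroup_doubling tu subKE KE_gt0.
exists (colourings u (fun t => KI (t ++ [:: false])) [::]), b, b'; split=> //.
  rewrite -bE /count_colourings colourings_cat.
  apply: (eq_colourings tu) => // t /splitm[t1 [c [d [t2 [-> st1 st2]]]]].
  rewrite big_bool /= -!catA !(KI_ _ _ _ _ _ st1 st2).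
  by case: c d => [] []; rewrite ?mul1n ?mul0n ?addn0.
have -> : colourings u (fun t => KI (t ++ [:: false])) [::] =
          colourings u (fun t => KE (t ++ [:: false])) [::].
  apply: (eq_colourings tu) => // t /splitm[t1 [c [d [t2 [-> st1 st2]]]]].
  rewrite -!catA !(KI_ _ _ _ _ _ st1 st2) (KE_ _ _ _ _ _ st1 st2).
  by rewrite !addbF; case: c d => [] [].
rewrite -b'E /count_colourings !colourings_cat.
apply: (eq_colourings tu) => // t /splitm[t1 [c [d [t2 [-> st1 st2]]]]].
rewrite colourings_cat (turnback_colourings _ _ _ _ st1) !big_bool /= -!catA.
rewrite !(KE_ _ _ _ _ _ st1 st2) -mulnDr -/W.
by case: c d => [] []; rewrite ?mul0n ?mul1n //= addnC.
Qed.

(** * Crossingless diagrams reduce to rows of circles *)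

Inductive planar_or_R2 : seq slice -> seq slice -> Prop :=
| PlanarMove l r of planar_isotopy_move l r : planar_or_R2 l r
| R2Move l r of reidemeister2 l r : planar_or_R2 l r.

(** The third Reidemeister move is left out, because [parity] below does not
    survive it. Both sides of each step are tangles, as a move with an empty side
    makes sense only where enough strands are present. *)
Inductive R2_equiv (m n : nat) : seq slice -> seq slice -> Prop :=
| R2Step u l r v p q of planar_or_R2 l r &
    is_tangle u m p & is_tangle l p q & is_tangle r p q & is_tangle v q n :
    R2_equiv m n (u ++ l ++ v) (u ++ r ++ v)
| R2Refl w : R2_equiv m n w w
| R2Sym w w' of R2_equiv m n w w' : R2_equiv m n w' w
| R2Trans w w' w'' of R2_equiv m n w w' & R2_equiv m n w' w'' :
    R2_equiv m n w w''.

Lemma R2_equiv_tangle m n w w' :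
  R2_equiv m n w w' -> is_tangle w m n = is_tangle w' m n.
Proof.
elim=> {w w'} [u l r v p q _ tu tl tr tv | // | w w' _ -> // |
  w w' w'' _ -> _ -> //].
by rewrite !(tangle_cat _ _ tu) (tangle_cat _ _ tl) (tangle_cat _ _ tr).
Qed.

Lemma R2_equiv_catr m k n w w' v :
  R2_equiv m k w w' -> is_tangle v k n -> R2_equiv m n (w ++ v) (w' ++ v).
Proof.
move=> ww' tv; elim: ww' => {w w'} [u l r u' p q lr tu tl tr tu' | w | w w' _ |
  w w' w'' _ H1 _ H2]; [|exact: R2Refl|exact: R2Sym|exact: R2Trans H1 H2].
by rewrite -!catA; apply: (R2Step lr tu tl tr); rewrite (tangle_cat _ _ tu').
Qed.

Lemma R2_equiv_catl m k n u w w' :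
  is_tangle u m k -> R2_equiv k n w w' -> R2_equiv m n (u ++ w) (u ++ w').
Proof.
move=> tu; elim=> {w w'} [u' l r v p q lr tu' tl tr tv | w | w w' _ |
  w w' w'' _ H1 _ H2]; [|exact: R2Refl|exact: R2Sym|exact: R2Trans H1 H2].
rewrite !(catA u); apply: (R2Step lr _ tl tr tv).
by rewrite (tangle_cat _ _ tu).
Qed.

Lemma R2_equiv_move m n l r : planar_or_R2 l r ->
  is_tangle l m n -> is_tangle r m n -> R2_equiv m n l r.
Proof.
move=> lr tl tr; rewrite -[l]cats0 -[r]cats0.
by apply: (@R2Step m n [::] l r [::] m n) => //=.
Qed.

Lemma R2_equiv_count w w' :
  R2_equiv 0 0 w w' -> count_colourings w = count_colourings w'.
Proof.
elim=> {w w'} [u l r v p q lr tu tl tr tv | // | w w' _ -> // |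
  w w' w'' _ -> _ -> //].
rewrite /count_colourings !colourings_cat.
apply: (eq_colourings tu) => // t st; rewrite !colourings_cat.
case: lr tl tr => {}l {}r lr tl tr.
  exact: (planar_isotopy_equicolourable lr tl).
exact: (reidemeister2_equicolourable lr tl).
Qed.

(** Chosen so that a maximum and a minimum in a zigzag cancel while those of a
    circle, or of a surgery, add up to an odd number, wherever they sit. *)
Definition slice_parity (s : slice) : bool :=
  if s.1 is Cap then ~~ odd s.2 else odd s.2.

Definition parity (w : seq slice) : bool :=
  foldr (fun s b => slice_parity s (+) b) false w.

Lemma parity_cat u v : parity (u ++ v) = parity u (+) parity v.
Proof. by elim: u => [|s u IHu] //=; rewrite IHu addbA. Qed.

Lemma R2_equiv_parity m n w w' : R2_equiv m n w w' -> parity w = parity w'.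
Proof.
elim=> {w w'} [u l r v p q lr _ _ _ _ | // | w w' _ -> // |
  w w' w'' _ -> _ -> //].
rewrite !parity_cat; congr (_ (+) (_ (+) _)).
case: lr => {}l {}r [] {l r}.
- move=> p' q' i k; rewrite /= /slice_parity /=.
  have even_in : odd (strands_in p') = false by case: (p').
  have even_out : odd (strands_out p') = false by case: (p').
  rewrite !oddD even_in even_out; move: (odd i) (odd k).
  by case: p' q' {even_in even_out} => [||?] [||?] [] [].
- by move=> i; rewrite /= /slice_parity /=; case: (odd i).
- by move=> i; rewrite /= /slice_parity /=; case: (odd i).
- by move=> b i; rewrite /= /slice_parity /=; case: (odd i).
- by move=> b i; rewrite /= /slice_parity /=; case: (odd i).
- by move=> b i; rewrite /= /slice_parity /=; case: (odd i).
Qed.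

Lemma parity_circles k : parity (circles k) = odd k.
Proof. by elim: k => [|k IHk] //=; rewrite -/(circles k) IHk. Qed.

Lemma count_circles k : count_colourings (circles k) = 2 ^ k.
Proof.
elim: k => [|k IHk] //; rewrite expnS -IHk.
rewrite -[circles k.+1]/([:: (Cup, 0); (Cap, 0)] ++ circles k).
by rewrite /count_colourings colourings_cat circle_colourings.
Qed.

(** The circle is pushed over the strand: a second Reidemeister move makes them
    overlap, the crossings slide around the extrema of the circle, and another
    such move separates them on the other side. *)
Lemma circle_across_strand m i : i < m ->
  R2_equiv m m [:: (Cup, i.+1); (Cap, i.+1)] [:: (Cup, i); (Cap, i)].
Proof.
move=> lt_im.
have step1 : R2_equiv m m
   ([:: (Cup, i.+1)] ++ [:: (Cross true, i); (Cross false, i)] ++ [:: (Cap, i.+1)])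
   ([:: (Cup, i.+1)] ++ [::] ++ [:: (Cap, i.+1)]).
  apply: (@R2Step m m _ _ _ _ m.+2 m.+2) => /=; try by lia.
  by apply: R2Move; apply: (R2 true).
have step2 : R2_equiv m m
   ([::] ++ [:: (Cup, i); (Cross false, i.+1)] ++ [:: (Cross false, i); (Cap, i.+1)])
   ([::] ++ [:: (Cup, i.+1); (Cross true, i)] ++ [:: (Cross false, i); (Cap, i.+1)]).
  apply: (@R2Step m m _ _ _ _ m m.+2) => /=; try by lia.
  by apply: PlanarMove; apply: (IsoCupCross false).
have step3 : R2_equiv m m
   ([:: (Cup, i); (Cross false, i.+1)] ++ [:: (Cross false, i); (Cap, i.+1)] ++ [::])
   ([:: (Cup, i); (Cross false, i.+1)] ++ [:: (Cross true, i.+1); (Cap, i)] ++ [::]).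
  apply: (@R2Step m m _ _ _ _ m.+2 m) => /=; try by lia.
  by apply: PlanarMove; apply: (IsoCrossCap false).
have step4 : R2_equiv m m
   ([:: (Cup, i)] ++ [:: (Cross false, i.+1); (Cross true, i.+1)] ++ [:: (Cap, i)])
   ([:: (Cup, i)] ++ [::] ++ [:: (Cap, i)]).
  apply: (@R2Step m m _ _ _ _ m.+2 m.+2) => /=; try by lia.
  by apply: R2Move; apply: (R2 false).
apply: (R2Trans (R2Sym step1)); apply: (R2Trans (R2Sym step2)).
exact: (R2Trans step3 step4).
Qed.

Lemma circle_leftmost m i : i <= m ->
  R2_equiv m m [:: (Cup, i); (Cap, i)] [:: (Cup, 0); (Cap, 0)].
Proof.
elim: i => [|i IHi] lt_im; first exact: R2Refl.
by apply: R2Trans (circle_across_strand lt_im) (IHi (ltnW lt_im)).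
Qed.

Lemma circle_to_bottom w m n : is_tangle w m n ->
  R2_equiv m n (w ++ [:: (Cup, 0); (Cap, 0)]) ([:: (Cup, 0); (Cap, 0)] ++ w).
Proof.
elim: w m => [|[q j] w IHw] m; first by move=> _; apply: R2Refl.
move=> /= /andP[le_m tw].
pose m' := m - strands_in q + strands_out q.
have tq : is_tangle [:: (q, j)] m m' by rewrite /= eqxx andbT.
have H1 := R2_equiv_catl tq (IHw _ tw).
apply: R2Trans H1 _.
apply: (@R2_equiv_catr m m' n [:: (q, j); (Cup, 0); (Cap, 0)]
  [:: (Cup, 0); (Cap, 0); (q, j)] w _ tw).
have H2 : R2_equiv m m'
  ([::] ++ [:: (Cup, 0); (q, 0 + 2 + j)] ++ [:: (Cap, 0)])
  ([::] ++ [:: (q, 0 + 0 + j); (Cup, 0)] ++ [:: (Cap, 0)]).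
  apply: (@R2Step m m' _ _ _ _ m m'.+2) => /=; rewrite ?/m'; try by lia.
  by apply: PlanarMove; apply: (@IsoExchange Cup q).
have H3 : R2_equiv m m'
  ([:: (Cup, 0)] ++ [:: (Cap, 0); (q, 0 + 0 + j)] ++ [::])
  ([:: (Cup, 0)] ++ [:: (q, 0 + 2 + j); (Cap, 0)] ++ [::]).
  apply: (@R2Step m m' _ _ _ _ m.+2 m') => /=; rewrite ?/m'; try by lia.
  by apply: PlanarMove; apply: (@IsoExchange Cap q).
exact: R2Trans (R2Sym H2) (R2Sym H3).
Qed.

Definition is_crossing (p : piece) := if p is Cross _ then true else false.

Definition flat (w : seq slice) := all (fun s => ~~ is_crossing s.1) w.

Definition is_cup (p : piece) := if p is Cup then true else false.

Definition cups (w : seq slice) := all (fun s => is_cup s.1) w.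

(** The maximum meets the last minimum below it in a circle, in a zigzag, or in
    disjoint positions; in the last case it moves below it and the induction
    goes on. Circles are moved to the bottom. *)
Lemma cap_on_cups c n i :
  cups c -> is_tangle (c ++ [:: (Cap, i)]) 0 n ->
  exists k c', cups c' /\ R2_equiv 0 n (c ++ [:: (Cap, i)]) (circles k ++ c').
Proof.
elim/last_ind: c n i => [|c [p j] IHc] n i.
  by move=> _ /= /andP[]; rewrite addn2.
rewrite /cups all_rcons => /andP[]; case: p => //= _ cups_c.
rewrite cat_rcons => /tangle_split[m tc] /and3P[le_j le_i /eqP eq_n].
rewrite /= in le_j le_i eq_n; have def_m : m = n by lia.
rewrite {}def_m {m} in tc le_j le_i eq_n *.
have [def_j|ne_ij] := eqVneq i j.
  exists 1, c; split=> //; rewrite {i le_i}def_j {eq_n}.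
  apply: R2Trans (circle_to_bottom tc).
  by apply: R2_equiv_catl tc (circle_leftmost _); lia.
have zig : (i == j.+1) || (j == i.+1) ->
    exists k c', cups c' /\ R2_equiv 0 n (c ++ [:: (Cup, j); (Cap, i)]) (circles k ++ c').
  move=> adj; exists 0, c; split=> //.
  rewrite -[circles 0 ++ c]/c -[X in R2_equiv _ _ _ X]cats0; apply: R2_equiv_catl tc _.
  case/orP: adj => /eqP adj; rewrite {}adj in le_i le_j ne_ij eq_n *;
    apply: R2_equiv_move => //=; try lia; apply: PlanarMove.
    exact: IsoZigzagL.
  exact: IsoZigzagR.
have [/zig // | not_adj] := boolP ((i == j.+1) || (j == i.+1)).
have commute : exists i' j',
  [/\ R2_equiv n n [:: (Cup, j); (Cap, i)] [:: (Cap, i'); (Cup, j')],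
      i' + 2 <= n & j' + 2 <= n].
  have [le_ij|lt_ji] := leqP i j.
    have [k def_j] : exists k, j = i + 2 + k by exists (j - (i + 2)); lia.
    exists i, (i + 0 + k); split; try lia; rewrite def_j in le_j le_i *.
    apply: R2Sym; apply: R2_equiv_move => /=; try lia.
    by apply: PlanarMove; apply: (@IsoExchange Cap Cup).
  have [k def_i] : exists k, i = j + 2 + k by exists (i - (j + 2)); lia.
  exists (j + 0 + k), j; split; try lia; rewrite def_i in le_j le_i *.
  apply: R2_equiv_move => /=; try lia.
  by apply: PlanarMove; apply: (@IsoExchange Cup Cap).
have [i' [j' [comm le_i' le_j']]] := commute.
have tci : is_tangle (c ++ [:: (Cap, i')]) 0 (n - 2).
  by rewrite (tangle_cat _ _ tc) /=; lia.
have [k [c' [cups_c' eq_c']]] := IHc _ _ cups_c tci.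
exists k, (c' ++ [:: (Cup, j')]); split.
  by rewrite all_cat (cups_c' : all _ _).
apply: R2Trans (R2_equiv_catl tc comm) _.
have tj' : is_tangle [:: (Cup, j')] (n - 2) n by rewrite /=; lia.
by have := R2_equiv_catr eq_c' tj'; rewrite -!catA.
Qed.

Lemma circles_cat k l : circles (k + l) = circles k ++ circles l.
Proof. by rewrite /circles nseqD flatten_cat. Qed.

Lemma cups_size c m n : cups c -> is_tangle c m n -> n = m + (size c).*2.
Proof.
elim: c m => [|[p i] c IHc] m /=; first by move=> _ /eqP; lia.
by case: p => //= cups_c /andP[_ /(IHc _ cups_c)]; lia.
Qed.

Lemma flat_normal_form w n : flat w -> is_tangle w 0 n ->
  exists k c, cups c /\ R2_equiv 0 n w (circles k ++ c).
Proof.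
elim/last_ind: w n => [|w [p i] IHw] n.
  by move=> _ _; exists 0, [::]; split=> //; apply: R2Refl.
rewrite /flat all_rcons => /andP[flat_p flat_w]; rewrite -cats1.
case/tangle_split=> m tw tp; have [k [c [cups_c eq_w]]] := IHw m flat_w tw.
have eq_wp := R2_equiv_catr eq_w tp.
case: p => // in flat_p tp eq_wp *.
  exists k, (c ++ [:: (Cup, i)]); rewrite /cups all_cat.
  by split; [apply/andP | rewrite catA].
have tc : is_tangle (c ++ [:: (Cap, i)]) 0 n.
  by have := tp; rewrite -(tangle_cat _ _ tw) (R2_equiv_tangle eq_wp) -catA
    (tangle_cat _ _ (tangle_circles k 0)).
have [l [c' [cups_c' eq_c]]] := cap_on_cups cups_c tc.
exists (k + l), c'; split=> //; apply: R2Trans eq_wp _.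
by rewrite circles_cat -!catA; apply: R2_equiv_catl eq_c; apply: tangle_circles.
Qed.

(** * The number of loops of a crossingless diagram *)

(** The logarithm is exact on crossingless diagrams, by [flat_count]. *)
Definition loops w := logn 2 (count_colourings w).

Lemma loops_circles k : loops (circles k) = k.
Proof. by rewrite /loops count_circles pfactorK. Qed.

Lemma flat_loops w : flat w -> is_tangle w 0 0 -> R2_equiv 0 0 w (circles (loops w)).
Proof.
move=> flat_w tw; have [k [c [cups_c eq_w]]] := flat_normal_form flat_w tw.
have tc := tw; rewrite (R2_equiv_tangle eq_w) in tc.
rewrite (tangle_cat _ _ (tangle_circles k 0)) in tc.
have /eqP := cups_size cups_c tc.
rewrite add0n eq_sym double_eq0 => /nilP c_nil; rewrite c_nil cats0 in eq_w.
by rewrite /loops (R2_equiv_count eq_w) -/(loops _) loops_circles.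
Qed.

Lemma flat_count w : flat w -> is_tangle w 0 0 -> count_colourings w = 2 ^ loops w.
Proof.
by move=> flat_w tw; rewrite (R2_equiv_count (flat_loops flat_w tw)) count_circles.
Qed.

Lemma flat_parity w : flat w -> is_tangle w 0 0 -> odd (loops w) = parity w.
Proof.
by move=> flat_w tw; rewrite (R2_equiv_parity (flat_loops flat_w tw)) parity_circles.
Qed.

(** The two constant colourings are distinct, so there are at least 2 ^ 1. *)
Lemma loops_gt0 w : flat w -> is_tangle w 0 0 -> 0 < size w -> 0 < loops w.
Proof.
move=> flat_w tw w_gt0; rewrite lt0n; apply/eqP => loops0.
have := flat_count flat_w tw; rewrite loops0.
case: w {flat_w loops0} tw w_gt0 => [//|[[||b] i] w] /=; rewrite ?addn2 //.
case: i => // /andP[_ tw] _.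
have pos b : 0 < colourings w empty_top [:: b; b].
  exact: (@colourings_nseq w 2 0 empty_top b tw).
rewrite /count_colourings -/(colourings ((Cup, 0) :: w) _ _) /= !(big_cons, big_nil).
by have := pos true; have := pos false; rewrite /=; lia.
Qed.

Lemma flat_cat u v : flat (u ++ v) = flat u && flat v.
Proof. exact: all_cat. Qed.

Lemma flat_circles k : flat (circles k).
Proof. by elim: k. Qed.

(** By [surgery_colourings] the counts 2 ^ n and 2 ^ n' are equal or differ by a
    factor 2; they are not equal because n and n' have different parities. *)
Lemma surgery_loops u v m i :
  flat u -> flat v -> is_tangle u 0 m -> is_tangle v m 0 -> i + 2 <= m ->
  let n := loops (u ++ v) in
  let n' := loops (u ++ [:: (Cap, i); (Cup, i)] ++ v) in
  n' = n.+1 \/ n = n'.+1.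
Proof.
move=> flat_u flat_v tu tv le_m n n'.
have tuv : is_tangle (u ++ v) 0 0 by rewrite (tangle_cat _ _ tu).
have tE : is_tangle [:: (Cap, i); (Cup, i)] m m by rewrite /=; lia.
have tuEv : is_tangle (u ++ [:: (Cap, i); (Cup, i)] ++ v) 0 0.
  by rewrite (tangle_cat _ _ tu) (tangle_cat _ _ tE).
have flat_uv : flat (u ++ v) by rewrite flat_cat flat_u.
have flat_uEv : flat (u ++ [:: (Cap, i); (Cup, i)] ++ v).
  by rewrite !flat_cat flat_u flat_v.
have neq : odd n' != odd n.
  rewrite !flat_parity // !parity_cat /= /slice_parity /=.
  by case: (odd i) (parity u) (parity v) => [] [] [].
have [z [b [b' [z_gt0]]]] := surgery_colourings tu tv le_m.
rewrite !flat_count // -/n -/n' => n_eq n'_eq.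
have expn2I : injective (expn 2) by apply: expnI.
case: b b' n_eq n'_eq => [] [] n_eq n'_eq; rewrite ?mul1n in n_eq n'_eq.
- by rewrite -n_eq in n'_eq; rewrite (expn2I _ _ n'_eq) eqxx in neq.
- by right; apply: expn2I; rewrite n_eq expnS n'_eq.
- by left; apply: expn2I; rewrite n'_eq expnS n_eq.
- by rewrite -n_eq in n'_eq; rewrite (expn2I _ _ n'_eq) eqxx in neq.
Qed.

Lemma circle_loops u v m i :
  flat u -> flat v -> is_tangle u 0 m -> is_tangle v m 0 -> i <= m ->
  loops (u ++ [:: (Cup, i); (Cap, i)] ++ v) = (loops (u ++ v)).+1.
Proof.
move=> flat_u flat_v tu tv le_m.
have tC : is_tangle [:: (Cup, i); (Cap, i)] m m by rewrite /=; lia.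
apply: (@expnI 2) => //; rewrite expnS -!flat_count ?flat_cat ?flat_u //.
- rewrite /count_colourings !colourings_cat.
  rewrite (eq_colourings (K' := fun t => \sum_(j <- [:: true; false]) colourings v empty_top t) tu) //.
    by rewrite sum_colourings !(big_cons, big_nil) addn0 mul2n addnn.
  move=> t st; rewrite colourings_cat circle_colourings ?st //.
  by rewrite !(big_cons, big_nil) addn0 mul2n addnn.
- by rewrite (tangle_cat _ _ tu).
- by rewrite (tangle_cat _ _ tu) (tangle_cat _ _ tC).
Qed.

(** * The state sum *)

Section StateSum.

Variables (A : Type) (op : A -> A -> A) (a : nat -> A).
Hypothesis hA : kauffman_bracket_magma op a.

(** A binary tree of [op] with one level for each crossing. The function [f] at
    the leaves is arbitrary, so that it may insert the state into a larger
    diagram before evaluating it. *)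
Fixpoint state_sum (w : seq slice) (f : seq slice -> A) : A :=
  if w is (p, i) :: w' then
    if p is Cross b then
      op (state_sum w' (fun x => f (smoothing_0 b i ++ x)))
         (state_sum w' (fun x => f (smoothing_inf b i ++ x)))
    else state_sum w' (fun x => f ((p, i) :: x))
  else f [::].

Lemma state_sum_flat f w : flat w -> state_sum w f = f w.
Proof. by elim: w f => [|[[||b] i] w IHw] f //= /IHw->. Qed.

Lemma eq_state_sum w m n f g : is_tangle w m n ->
  (forall x, flat x -> is_tangle x m n -> f x = g x) ->
  state_sum w f = state_sum w g.
Proof.
elim: w m f g => [|[p i] w IHw] m f g /=; first by move=> tw ->.
case/andP=> le_m tw eq_fg; case: p le_m tw => [||b] le_m tw /=.
- apply: (IHw _ _ _ tw) => x flat_x tx; apply: eq_fg => //=.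
  by rewrite tx andbT.
- apply: (IHw _ _ _ tw) => x flat_x tx; apply: eq_fg => //=.
  by rewrite tx andbT.
rewrite /= in le_m tw; have mE : m - 2 + 2 = m by lia.
rewrite mE in tw.
have sm c x : flat x -> is_tangle x m n ->
    f (smoothing_0 c i ++ x) = g (smoothing_0 c i ++ x).
  move=> flat_x tx; apply: eq_fg; first by rewrite flat_cat flat_x; case: (c).
  by rewrite (tangle_cat _ _ (tangle_smoothing c true le_m).1).
by congr op; apply: (IHw _ _ _ tw) => x; apply: sm.
Qed.

Lemma state_sum_cat u v f :
  state_sum (u ++ v) f = state_sum u (fun x => state_sum v (fun y => f (x ++ y))).
Proof.
elim: u f => [|[p i] u IHu] f //=.
case: p => [||b]; rewrite !IHu //.
by congr op; congr state_sum; apply: functional_extensionality => x;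
  congr state_sum; apply: functional_extensionality => y; rewrite catA.
Qed.

(** This is where entropicity enters: op is a homomorphism, hence so is every
    tree of op. *)
Lemma state_sum_op w f g :
  state_sum w (fun x => op (f x) (g x)) = op (state_sum w f) (state_sum w g).
Proof.
elim: w f g => [|[p i] w IHw] f g //=.
by case: p => [||b]; rewrite !IHw // (kbm_entropic hA).
Qed.

Lemma state_sum_exchange v w (f : seq slice -> seq slice -> A) :
  state_sum v (fun x => state_sum w (f x)) =
  state_sum w (fun y => state_sum v (f^~ y)).
Proof.
elim: v f => [|[p i] v IHv] f //=.
by case: p => [||b]; rewrite !IHv // -state_sum_op.
Qed.

Definition bracket w := state_sum w (fun x => a (loops x)).

(** The chosen crossing moves to the root of the tree, because the trees over the
    crossings that precede it are homomorphisms. *)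
Lemma bracket_skein u v b i :
  bracket (u ++ (Cross b, i) :: v) =
  op (bracket (u ++ smoothing_0 b i ++ v)) (bracket (u ++ smoothing_inf b i ++ v)).
Proof.
have sm c f : state_sum (smoothing_0 c i) f = f (smoothing_0 c i) by case: c.
rewrite /bracket !(state_sum_cat u) /= -state_sum_op.
congr state_sum; apply: functional_extensionality => x.
by rewrite /smoothing_inf !state_sum_cat !sm.
Qed.

(** * Invariance of the state sum *)

(** Equality inside every diagram, which makes rewriting in context possible;
    the diagrams [u] and [v] may contain crossings. *)
Definition bracket_equiv m n x y := forall u v,
  is_tangle u 0 m -> is_tangle v n 0 -> bracket (u ++ x ++ v) = bracket (u ++ y ++ v).

(** The crossings of [u] and [v] are resolved before those of [x] and [y], by
    [state_sum_exchange]. *)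
Lemma bracket_equiv_flat m n x y :
  (forall u v, flat u -> flat v -> is_tangle u 0 m -> is_tangle v n 0 ->
    state_sum x (fun z => a (loops (u ++ z ++ v))) =
    state_sum y (fun z => a (loops (u ++ z ++ v)))) ->
  bracket_equiv m n x y.
Proof.
move=> eq_xy u v tu tv; rewrite /bracket !(state_sum_cat u).
apply: (eq_state_sum tu) => u' flat_u' tu'; rewrite !state_sum_cat.
rewrite state_sum_exchange [RHS]state_sum_exchange.
apply: (eq_state_sum tv) => v' flat_v' tv'; exact: eq_xy.
Qed.

Lemma bracket_equiv_sym m n x y : bracket_equiv m n x y -> bracket_equiv m n y x.
Proof. by move=> eq_xy u v tu tv; rewrite eq_xy. Qed.

Lemma bracket_equiv_trans y m n x z :
  bracket_equiv m n x y -> bracket_equiv m n y z -> bracket_equiv m n x z.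
Proof. by move=> eq_xy eq_yz u v tu tv; rewrite eq_xy ?eq_yz. Qed.

Lemma bracket_equiv_cat m p q n u x y v :
  is_tangle u m p -> bracket_equiv p q x y -> is_tangle v q n ->
  bracket_equiv m n (u ++ x ++ v) (u ++ y ++ v).
Proof.
move=> tu eq_xy tv u' v' tu' tv'.
rewrite -!catA !(catA u'); apply: eq_xy; first by rewrite (tangle_cat _ _ tu').
by rewrite (tangle_cat _ _ tv).
Qed.

(** [e] tells which of the two smoothings is taken; the exclusive or converts
    this into the shape of the smoothed crossing, which depends on [b] and [c]. *)
Lemma bracket_equiv_resolve m n x1 x2 y1 y2 b c i j :
  (forall e, bracket_equiv m n (x1 ++ smoothing_0 (e (+) b) i ++ x2)
                               (y1 ++ smoothing_0 (e (+) c) j ++ y2)) ->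
  bracket_equiv m n (x1 ++ (Cross b, i) :: x2) (y1 ++ (Cross c, j) :: y2).
Proof.
move=> eq_xy u v tu tv.
have := eq_xy false u v tu tv; have := eq_xy true u v tu tv.
rewrite -!catA !addTb !addFb => eq1 eq0.
rewrite /= (catA u x1) (catA u y1) !bracket_skein -!catA /smoothing_inf.
by rewrite eq0 eq1.
Qed.

Lemma bracket_equiv_equicolourable m n l r :
  flat l -> flat r -> is_tangle l m n -> is_tangle r m n ->
  equicolourable m l r -> bracket_equiv m n l r.
Proof.
move=> flat_l flat_r tl tr eq_lr; apply: bracket_equiv_flat => u v flat_u flat_v tu tv.
rewrite !state_sum_flat //; congr a; rewrite /loops; congr logn.
rewrite /count_colourings !colourings_cat; apply: (eq_colourings tu) => // t st.
by rewrite !colourings_cat eq_lr.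
Qed.

Lemma exchange_flat_bracket p q i k m n :
  ~~ is_crossing p -> ~~ is_crossing q ->
  is_tangle [:: (p, i); (q, i + strands_out p + k)] m n ->
  bracket_equiv m n [:: (p, i); (q, i + strands_out p + k)]
                    [:: (q, i + strands_in p + k); (p, i)].
Proof.
move=> flat_p flat_q tl; apply: bracket_equiv_equicolourable => //=.
- by rewrite flat_p flat_q.
- by rewrite flat_p flat_q.
- by move: tl => /=; lia.
exact: exchange_equicolourable tl.
Qed.

(** If [q] is a crossing, each of its smoothings consists of pieces that can be
    exchanged with [p] one after the other. *)
Lemma exchange_flat_any_bracket p q i k m n :
  ~~ is_crossing p ->
  is_tangle [:: (p, i); (q, i + strands_out p + k)] m n ->
  bracket_equiv m n [:: (p, i); (q, i + strands_out p + k)]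
                    [:: (q, i + strands_in p + k); (p, i)].
Proof.
move=> flat_p; case: q => [||b] tl; try exact: exchange_flat_bracket.
have /= /and3P[le1 le2 eq_n] := tl.
apply: (@bracket_equiv_resolve m n [:: (p, i)] [::] [::] [:: (p, i)] b b) => e.
rewrite cats0 /=; case: (e (+) b) => //=.
have step1 : bracket_equiv m n
    ([::] ++ [:: (p, i); (Cap, i + strands_out p + k)] ++
      [:: (Cup, i + strands_out p + k)])
    ([::] ++ [:: (Cap, i + strands_in p + k); (p, i)] ++
      [:: (Cup, i + strands_out p + k)]).
  apply: (@bracket_equiv_cat _ m (n - 2)) => //=; last by lia.
  by apply: exchange_flat_bracket => //=; lia.
apply: bracket_equiv_trans step1 _.
have step2 : bracket_equiv m n
    ([:: (Cap, i + strands_in p + k)] ++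
      [:: (p, i); (Cup, i + strands_out p + k)] ++ [::])
    ([:: (Cap, i + strands_in p + k)] ++
      [:: (Cup, i + strands_in p + k); (p, i)] ++ [::]).
  apply: (@bracket_equiv_cat _ (m - 2) n) => //=; first by lia.
  by apply: exchange_flat_bracket => //=; lia.
exact: step2.
Qed.

Lemma exchange_bracket p q i k m n :
  is_tangle [:: (p, i); (q, i + strands_out p + k)] m n ->
  bracket_equiv m n [:: (p, i); (q, i + strands_out p + k)]
                    [:: (q, i + strands_in p + k); (p, i)].
Proof.
case: p => [||b] tl; try exact: exchange_flat_any_bracket.
have /= /and3P[le1 le2 eq_n] := tl.
apply: (@bracket_equiv_resolve m n [::] [:: (q, i + 2 + k)] [:: (q, i + 2 + k)] [::] b b) => e.
rewrite cats0 /=; case: (e (+) b) => //=.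
have step1 : bracket_equiv m n
    ([:: (Cap, i)] ++ [:: (Cup, i); (q, i + 2 + k)] ++ [::])
    ([:: (Cap, i)] ++ [:: (q, i + 0 + k); (Cup, i)] ++ [::]).
  apply: (@bracket_equiv_cat _ (m - 2) n) => //=; first by lia.
  by apply: (@exchange_flat_any_bracket Cup q) => //=; lia.
apply: bracket_equiv_trans step1 _.
have step2 : bracket_equiv m n
    ([::] ++ [:: (Cap, i); (q, i + 0 + k)] ++ [:: (Cup, i)])
    ([::] ++ [:: (q, i + 2 + k); (Cap, i)] ++ [:: (Cup, i)]).
  apply: (@bracket_equiv_cat _ m (n - 2)) => //=; last by lia.
  by apply: (@exchange_flat_any_bracket Cap q) => //=; lia.
exact: step2.
Qed.

Lemma flat_isotopy_bracket m n l r : planar_isotopy_move l r -> flat l -> flat r ->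
  is_tangle l m n -> is_tangle r m n -> bracket_equiv m n l r.
Proof.
move=> lr flat_l flat_r tl tr; apply: bracket_equiv_equicolourable => //.
exact: planar_isotopy_equicolourable lr tl.
Qed.

Lemma cross_cap_bracket b i m n :
  is_tangle [:: (Cross b, i); (Cap, i.+1)] m n ->
  bracket_equiv m n [:: (Cross b, i); (Cap, i.+1)]
                    [:: (Cross (~~ b), i.+1); (Cap, i)].
Proof.
move=> /= /and3P[le1 le2 eq_n].
apply: (@bracket_equiv_resolve m n [::] [:: (Cap, i.+1)] [::] [:: (Cap, i)] b (~~ b)) => e.
rewrite addbN /=; case: (e (+) b) => /=.
  apply: bracket_equiv_sym.
  have := @bracket_equiv_cat m (m - 2) n n [:: (Cap, i.+1)] [:: (Cup, i.+1); (Cap, i)] [::] [::].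
  apply=> //=; try by lia.
  apply: flat_isotopy_bracket => //=; try lia; exact: IsoZigzagR.
have := @bracket_equiv_cat m (m - 2) n n [:: (Cap, i)] [:: (Cup, i); (Cap, i.+1)] [::] [::].
apply=> //=; try by lia.
apply: flat_isotopy_bracket => //=; try lia; exact: IsoZigzagL.
Qed.

Lemma cup_cross_bracket b i m n :
  is_tangle [:: (Cup, i); (Cross b, i.+1)] m n ->
  bracket_equiv m n [:: (Cup, i); (Cross b, i.+1)]
                    [:: (Cup, i.+1); (Cross (~~ b), i)].
Proof.
move=> /= /and3P[le1 le2 eq_n].
apply: (@bracket_equiv_resolve m n [:: (Cup, i)] [::] [:: (Cup, i.+1)] [::] b (~~ b)) => e.
rewrite addbN !cats0; case: (e (+) b) => /=.
  apply: bracket_equiv_sym.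
  have := @bracket_equiv_cat m m m n [::] [:: (Cup, i.+1); (Cap, i)] [::] [:: (Cup, i)].
  apply=> //=; try by lia.
  apply: flat_isotopy_bracket => //=; try lia; exact: IsoZigzagR.
have := @bracket_equiv_cat m m m n [::] [:: (Cup, i); (Cap, i.+1)] [::] [:: (Cup, i.+1)].
apply=> //=; try by lia.
apply: flat_isotopy_bracket => //=; try lia; exact: IsoZigzagL.
Qed.

Lemma planar_isotopy_bracket m n l r :
  planar_isotopy_move l r -> is_tangle l m n -> bracket_equiv m n l r.
Proof.
case=> {l r} [p q i k|i|i|b i|b i] tl.
- exact: exchange_bracket.
- apply: flat_isotopy_bracket => //; first exact: IsoZigzagL.
  by move: tl => /=; lia.
- apply: flat_isotopy_bracket => //; first exact: IsoZigzagR.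
  by move: tl => /=; lia.
- exact: cross_cap_bracket.
- exact: cup_cross_bracket.
Qed.

(** The smoothings of the two crossings that leave two vertical strands occur on
    opposite sides of [op], so the value is one of the two expressions of
    [sum_eq]. Both are a_k: by [kbm_i_left] and [kbm_i_right] if k' = k + 1, and
    by [kbm_ii] if k = k' + 1. *)
Lemma reidemeister2_bracket m n l r :
  reidemeister2 l r -> is_tangle l m n -> bracket_equiv m n l r.
Proof.
case=> {l r} b i /= /and3P[le_m _ /eqP eq_n].
have -> : n = m by lia.
apply: bracket_equiv_flat => u v flat_u flat_v tu tv.
pose E := [:: (Cap, i); (Cup, i)].
have tE : is_tangle E m m by rewrite /=; lia.
pose k := loops (u ++ v); pose k' := loops (u ++ E ++ v).
have EE : loops (u ++ E ++ E ++ v) = k'.+1.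
  have := @circle_loops (u ++ [:: (Cap, i)]) ([:: (Cup, i)] ++ v) (m - 2) i.
  rewrite /k' /E -!catA /= => -> //.
  - by rewrite flat_cat flat_u.
  - by rewrite (tangle_cat _ _ tu) /=; lia.
  - by rewrite /= subn0 subnK ?tv ?andbT; lia.
  - lia.
have k_gt0 : 0 < k.
  apply: loops_gt0; first by rewrite flat_cat flat_u.
    by rewrite (tangle_cat _ _ tu).
  rewrite size_cat lt0n addn_eq0 negb_and; apply/orP; left; apply/eqP.
  by move/size0nil => u0; move: tu; rewrite u0 /= => /eqP; lia.
have k'_gt0 : 0 < k'.
  apply: loops_gt0; first by rewrite !flat_cat flat_u.
    by rewrite (tangle_cat _ _ tu) (tangle_cat _ _ tE).
  by rewrite !size_cat /=; lia.
have surg : k' = k.+1 \/ k = k'.+1 by apply: surgery_loops tv le_m.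
have sum_eq : op (op (a k') (a k)) (op (a k'.+1) (a k')) = a k /\
              op (op (a k') (a k'.+1)) (op (a k) (a k')) = a k.
  case: surg => ->; first by rewrite (kbm_i_left hA) ?(kbm_i_right hA).
  by rewrite (kbm_ii hA).
have loopsE : loops (u ++ [:: (Cap, i), (Cup, i) & v]) = k' by [].
have loopsEE : loops (u ++ [:: (Cap, i), (Cup, i), (Cap, i), (Cup, i) & v])
  = k'.+1 := EE.
by case: b => /=; rewrite loopsE loopsEE; case: sum_eq.
Qed.

Lemma cross_cross_bracket b i m : i + 2 <= m ->
  bracket_equiv m m [:: (Cross b, i); (Cross (~~ b), i)] [::].
Proof.
by move=> le_m; apply: reidemeister2_bracket; [exact: R2 | rewrite /=; lia].
Qed.

(** Strand 1 or strand 3 lies entirely above or entirely below both others.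
    Resolve the crossing of these others: one smoothing makes the two sides
    equal, and after the other one the outer strand slides off the two extrema
    by a second Reidemeister move. *)
Lemma reidemeister3_bracket m n l r :
  reidemeister3 l r -> is_tangle l m n -> bracket_equiv m n l r.
Proof.
case=> {l r} b12 b13 b23 i lev /= tl.
have [le_m -> {n tl}] : i + 3 <= m /\ n = m by lia.
have cat_equiv := @bracket_equiv_cat m _ _ m.
case/orP: lev => /eqP ->.
  (* Strand 1 lies above or below both others. *)
  apply: (@bracket_equiv_resolve m m [:: (Cross b12, i); (Cross b12, i.+1)] [::]
           [::] [:: (Cross b12, i); (Cross b12, i.+1)] b23 b23) => e.
  case: (e (+) b23) => //=.
  apply: (@bracket_equiv_trans [:: (Cap, i.+1); (Cup, i)]).
    have step1 := cat_equiv m (m - 2) [:: (Cross b12, i)]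
      [:: (Cross (~~ b12), i); (Cap, i.+1)] [:: (Cross b12, i.+1); (Cap, i)] [:: (Cup, i)].
    apply: (bracket_equiv_trans (bracket_equiv_sym (step1 _ _ _))) => /=; try lia.
      rewrite -{2}[b12]negbK; apply: cross_cap_bracket => /=; lia.
    apply: (cat_equiv m m [::] [:: (Cross b12, i); (Cross (~~ b12), i)] [::] [:: (Cap, i.+1); (Cup, i)]) => //=; try lia.
    by apply: cross_cross_bracket; lia.
  apply: bracket_equiv_sym.
  have step1 := cat_equiv (m - 2) m [:: (Cap, i.+1)]
      [:: (Cup, i); (Cross (~~ b12), i.+1)] [:: (Cup, i.+1); (Cross b12, i)] [:: (Cross b12, i.+1)].
  apply: (bracket_equiv_trans (bracket_equiv_sym (step1 _ _ _))) => /=; try lia.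
    rewrite -{2}[b12]negbK; apply: cup_cross_bracket => /=; lia.
  apply: (cat_equiv m m [:: (Cap, i.+1); (Cup, i)] [:: (Cross (~~ b12), i.+1); (Cross b12, i.+1)] [::] [::]) => //=; try lia.
  by rewrite -{2}[b12]negbK; apply: cross_cross_bracket; lia.
(* Strand 3 lies above or below both others. *)
apply: (@bracket_equiv_resolve m m [::] [:: (Cross b23, i.+1); (Cross b23, i)]
         [:: (Cross b23, i.+1); (Cross b23, i)] [::] b12 b12) => e.
case: (e (+) b12) => //=.
apply: (@bracket_equiv_trans [:: (Cap, i); (Cup, i.+1)]).
  have step1 := cat_equiv (m - 2) m [:: (Cap, i)]
      [:: (Cup, i); (Cross b23, i.+1)] [:: (Cup, i.+1); (Cross (~~ b23), i)] [:: (Cross b23, i)].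
  apply: (bracket_equiv_trans (step1 _ _ _)) => /=; try lia.
    apply: cup_cross_bracket => /=; lia.
  apply: (cat_equiv m m [:: (Cap, i); (Cup, i.+1)] [:: (Cross (~~ b23), i); (Cross b23, i)] [::] [::]) => //=; try lia.
  by rewrite -{2}[b23]negbK; apply: cross_cross_bracket; lia.
apply: bracket_equiv_sym.
have step1 := cat_equiv m (m - 2) [:: (Cross b23, i.+1)]
  [:: (Cross b23, i); (Cap, i.+1)] [:: (Cross (~~ b23), i.+1); (Cap, i)] [:: (Cup, i.+1)].
apply: (bracket_equiv_trans (step1 _ _ _)) => /=; try lia.
  apply: cross_cap_bracket => /=; lia.
apply: (cat_equiv m m [::] [:: (Cross b23, i.+1); (Cross (~~ b23), i.+1)] [::] [:: (Cap, i); (Cup, i.+1)]) => //=; try lia.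
by apply: cross_cross_bracket; lia.
Qed.

Lemma state_sum_shift_right w f :
  state_sum (shift_right w) f = state_sum w (fun x => f (shift_right x)).
Proof.
elim: w f => [|[p i] w IHw] f //=.
have sm c : shift_right (smoothing_0 c i) = smoothing_0 c i.+1 by case: c.
case: p => [||b]; rewrite !IHw //=.
by congr op; congr state_sum; apply: functional_extensionality => x;
  rewrite /shift_right map_cat -!/(shift_right _) sm.
Qed.

Lemma sphere_bracket l r : sphere_move l r -> bracket l = bracket r.
Proof.
case=> w tw; rewrite /bracket /= !state_sum_cat state_sum_shift_right /=.
apply: (eq_state_sum tw) => x flat_x tx.
by rewrite /loops count_closure.
Qed.

Lemma bracket_invariant :
  framed_link_invariant (fun D : link_diagram => bracket (val D)).
Proof.
move=> [w w_link] [w' w'_link] /= mv.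
have local u l r v m n : is_tangle u 0 m -> is_tangle v n 0 -> bracket_equiv m n l r ->
    bracket (u ++ l ++ v) = bracket (u ++ r ++ v) by move=> tu tv; apply.
case: mv w_link {w'_link} => {w w'} [u l r v lr|l r lr|u l r v lr|u l r v lr] /andP[_].
- case/tangle_split=> m tu /tangle_split[n tl tv].
  exact: (local _ _ _ _ _ _ tu tv (planar_isotopy_bracket lr tl)).
- by move=> _; exact: sphere_bracket.
- case/tangle_split=> m tu /tangle_split[n tl tv].
  exact: (local _ _ _ _ _ _ tu tv (reidemeister2_bracket lr tl)).
- case/tangle_split=> m tu /tangle_split[n tl tv].
  exact: (local _ _ _ _ _ _ tu tv (reidemeister3_bracket lr tl)).
Qed.

Lemma bracket_flat w : flat w -> bracket w = a (loops w).
Proof. exact: (state_sum_flat (fun x => a (loops x))). Qed.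

End StateSum.

(** * Uniqueness *)

(** A side of a move is empty only for a zigzag and for a pair of crossings. Both
    need a strand from below, so the rest of the diagram is not empty. *)
Lemma R2_equiv_nonempty w w' :
  R2_equiv 0 0 w w' -> (0 < size w) = (0 < size w').
Proof.
elim=> {w w'} [u l r v p q lr tu tl tr tv | // | w w' _ -> // |
  w w' w'' _ -> _ -> //].
case: u tu => [|s u] // /eqP def_p; rewrite -{}def_p in tl tr.
suff [l_gt0 r_gt0] : 0 < size l /\ 0 < size r by rewrite /= !size_cat !ltn_addr.
case: lr tl tr => {}l {}r [] {l r} /=; intros; lia.
Qed.

Lemma R2_equiv_invariant (A : Type) (P : link_diagram -> A) (D D' : link_diagram) :
  framed_link_invariant P -> R2_equiv 0 0 (val D) (val D') -> P D = P D'.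
Proof.
move=> inv; case: D D' => w w_link [w' w'_link] /= ww'.
elim: ww' w_link w'_link => {w w'} [u l r v p q lr tu tl tr tv | w | w w' _ IH |
  w w' w'' ww' IH1 w'w'' IH2] w_link w'_link.
- apply: inv => /=; case: lr tl tr => {}l {}r lr _ _ {p q tu tv w_link w'_link}.
    exact: MoveIsotopy.
  exact: MoveR2.
- by congr P; apply: val_inj.
- by rewrite -IH.
- have w'0_link : is_link_diagram w'.
    case/andP: w_link => w_gt0 tw.
    by rewrite /is_link_diagram -(R2_equiv_nonempty ww') w_gt0 -(R2_equiv_tangle ww').
  by rewrite (IH1 _ w'0_link) IH2.
Qed.

Lemma not_flat w : ~~ flat w -> exists u b i v, w = u ++ (Cross b, i) :: v.
Proof.
elim: w => [|[[||b] i] w IHw] //=; last by exists [::], b, i, w.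
- by case/IHw=> u [b [j [v ->]]]; exists ((Cup, i) :: u), b, j, v.
- by case/IHw=> u [b [j [v ->]]]; exists ((Cap, i) :: u), b, j, v.
Qed.

Lemma link_smoothing u v b c i : is_link_diagram (u ++ (Cross b, i) :: v) ->
  is_link_diagram (u ++ smoothing_0 c i ++ v).
Proof.
case/andP=> _ /tangle_split[m tu] /= /andP[le_m tv].
have mE : m - 2 + 2 = m by lia.
apply/andP; split.
  rewrite size_cat; case: u tu => [|//] /= /eqP m0; lia.
rewrite (tangle_cat _ _ tu) (tangle_cat _ _ (tangle_smoothing c true le_m).1).
by rewrite -{1}mE.
Qed.

Definition crossings (w : seq slice) := count (fun s => is_crossing s.1) w.

Lemma invariant_unique (A : Type) (op : A -> A -> A) (P Q : link_diagram -> A) :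
    framed_link_invariant P -> framed_link_invariant Q ->
    (forall n (n_gt0 : 0 < n), P (trivial_link n_gt0) = Q (trivial_link n_gt0)) ->
    (forall L L0 Linf, skein_triple L L0 Linf -> P L = op (P L0) (P Linf)) ->
    (forall L L0 Linf, skein_triple L L0 Linf -> Q L = op (Q L0) (Q Linf)) ->
  P =1 Q.
Proof.
move=> invP invQ eqT skP skQ D.
have [k] := ubnP (crossings (val D)); elim: k D => // k IHk D lt_k.
have [flat_D|/not_flat[u [b [i [v def_D]]]]] := boolP (flat (val D)).
  have /andP[D_gt0 tD] := valP D; have eq_D := flat_loops flat_D tD.
  have n_gt0 := loops_gt0 flat_D tD D_gt0.
  rewrite (@R2_equiv_invariant _ P D (trivial_link n_gt0)) //.
  by rewrite (@R2_equiv_invariant _ Q D (trivial_link n_gt0)).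
have D_link := valP D; rewrite def_D in D_link.
pose Ds c : link_diagram := Sub (u ++ smoothing_0 c i ++ v) (link_smoothing c D_link).
have sk : skein_triple D (Ds b) (Ds (~~ b)) by exists u, v, b, i; split.
have IH c : P (Ds c) = Q (Ds c).
  apply: IHk; move: lt_k; rewrite def_D /crossings /= !count_cat /=.
  by case: c => /=; lia.
by rewrite (skP _ _ _ sk) (skQ _ _ _ sk) !IH.
Qed.

Theorem theorem3p1 (A : Type) (op : A -> A -> A) (a : nat -> A)
    (hA : kauffman_bracket_magma op a) :
  exists! P : link_diagram -> A,
    [/\ framed_link_invariant P,
        forall (n : nat) (n_gt0 : 0 < n), P (trivial_link n_gt0) = a n
      & forall L L0 Linf : link_diagram,
          skein_triple L L0 Linf -> P L = op (P L0) (P Linf)].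
Proof.
pose P (D : link_diagram) := bracket op a (val D).
have invP : framed_link_invariant P := bracket_invariant hA.
have PT n (n_gt0 : 0 < n) : P (trivial_link n_gt0) = a n.
  by rewrite /P /= bracket_flat ?flat_circles // loops_circles.
have skP L L0 Linf : skein_triple L L0 Linf -> P L = op (P L0) (P Linf).
  by move=> [u [v [b [i [LE L0E LinfE]]]]]; rewrite /P LE L0E LinfE bracket_skein.
exists P; split=> // Q [invQ QT skQ].
apply: functional_extensionality => D.
apply: (invariant_unique invP invQ _ skP skQ) => n n_gt0.
by rewrite PT QT.
Qed.
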